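(* Let $N\in\mathbb{N}^*$ and let $W$ be a symmetric $N\times N$ random matrix whose entries on and above the diagonal are i.i.d. centred Gaussian with some variance $\sigma^2>0$. For $T\in\mathbb{N}^*$ let $B_{T,N}$ be its generalised matrix of moments of order $T$, with eigenvalues $\lambda_T(B_{T,N})\le\cdots\le\lambda_0(B_{T,N})=\lambda_{\max}(B_{T,N})$. Then \[ \frac{\lambda_{\max}(B_{T,N})}{\sum_{i=0}^T\lambda_i(B_{T,N})}\xrightarrow[T\to\infty]{}1, \qquad\text{and}\qquad \lambda_{\max}(B_{T,N})\simeq B_{T,N}(T,T)\ \text{ as } T\to\infty. \]
   Context: Generalised matrix of moments: for $i\in[N]$, $\beta_{i,0}=1$, $\beta_{i,l}=\sum_{i_1,\ldots,i_l=1}^N W_{ii_1}\cdots W_{i_{l-1}i_l}$ for $l\ge1$, and $B_{T,N}(l_1,l_2)=\mathbb{E}\sum_{i=1}^N\beta_{i,l_1}\beta_{i,l_2}$. $x_T\simeq y_T$ means $x_T/y_T\to1$. *)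

(* Defs.v *)
From HB Require Import structures.
From mathcomp Require Import all_boot all_order all_algebra.
From mathcomp Require Import all_classical all_reals all_analysis.
Set Implicit Arguments. Unset Strict Implicit. Unset Printing Implicit Defensive.
Import Order.TTheory GRing.Theory Num.Theory.
Local Open Scope classical_set_scope.
Local Open Scope ring_scope.

Definition mutually_independent d (Omega : measurableType d) (R : realType)
  (P : probability Omega R) (I : finType) (S : {pred I})
  (X : I -> {RV P >-> R}) : Prop :=
  forall A : I -> set R, (forall k, measurable (A k)) ->
    P (\bigcap_(k in [set k | k \in S]) (X k @^-1` A k)) =
    (\prod_(k in S) P (X k @^-1` A k))%E.

(* beta_{i,l} = sum over i_1..i_l of W_{i i_1} W_{i_1 i_2} ... W_{i_{l-1} i_l};
   a path is p : 'I_(l+1) -> 'I_N with p 0 = i and p k = i_k.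
   For l = 0 the sum has one term with empty product, so beta_{i,0} = 1. *)
Definition beta (R : realType) (N : nat) (W : 'I_N -> 'I_N -> R)
  (i : 'I_N) (l : nat) : R :=
  \sum_(p : {ffun 'I_l.+1 -> 'I_N} | p ord0 == i)
     \prod_(k < l) W (p (widen_ord (leqnSn l) k)) (p (lift ord0 k)).

Definition moments_matrix d (Omega : measurableType d) (R : realType)
  (P : probability Omega R) (N : nat) (W : 'I_N -> 'I_N -> {RV P >-> R})
  (T : nat) : 'M[R]_(T.+1) :=
  \matrix_(l1 < T.+1, l2 < T.+1)
    fine ('E_P[fun w => (\sum_(i < N)
                  beta (fun a b => W a b w) i l1 * beta (fun a b => W a b w) i l2)%R])%E.

Definition seqmax (R : realType) (s : seq R) : R :=
  foldr Num.max (head 0 s) s.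

(* Main.v *)
Require Import Defs.
From HB Require Import structures.
From mathcomp Require Import all_boot all_order all_algebra.
From mathcomp Require Import all_classical all_reals all_analysis.
From mathcomp Require Import measurable_realfun.
From mathcomp Require Import ring lra zify.
Set Implicit Arguments.
Unset Strict Implicit.
Unset Printing Implicit Defensive.
Import Order.TTheory GRing.Theory Num.Theory.
Import numFieldNormedType.Exports.
Local Open Scope classical_set_scope.
Local Open Scope ring_scope.

(** Since [W] is symmetric, [B_T(l1, l2) = m (l1 + l2)] with
    [m k = E (1^T W^k 1)]: [B_T] is a positive semidefinite Hankel matrix, hence
    [a n := m (2 n)] is log-convex and [a n.+1 / a n] is nondecreasing. By
    independence all the entries of [W] exceed a given [K] with positive probability,
    so [a] outgrows every geometric sequence, the ratios tend to infinity and
    [tr B_T = a 0 + ... + a T] is equivalent to [a T = B_T(T, T)]. Finally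
    [B_T(T, T)^2 <= tr (B_T^2) <= lambda_max * tr B_T] and [lambda_max <= tr B_T].
    All that is needed of the Gaussian law is that it has finite moments and charges
    every half-line [[K, +oo[]. *)

(** * The path sums as iterates of [W] *)

Section beta_theory.
Variables (R : realType) (N : nat) (W : 'I_N -> 'I_N -> R).

Lemma beta0 i : beta W i 0 = 1.
Proof.
rewrite /beta (big_pred1 [ffun=> i]) ?big_ord0// => p /=.
apply/eqP/eqP => [pi|->]; last by rewrite ffunE.
by apply/ffunP => k; rewrite ffunE ord1.
Qed.

Let cons_path l (i : 'I_N) (q : {ffun 'I_l.+1 -> 'I_N}) : {ffun 'I_l.+2 -> 'I_N} :=
  [ffun k => oapp q i (unlift ord0 k)].

Lemma betaS i l : beta W i l.+1 = \sum_j W i j * beta W j l.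
Proof.
pose tail_path (p : {ffun 'I_l.+2 -> 'I_N}) : {ffun 'I_l.+1 -> 'I_N} :=
  [ffun k => p (lift ord0 k)].
(* Prepending [i] is a bijection from all shorter paths onto the paths that start at [i]; its
   inverse is [tail_path]. *)
rewrite {1}/beta (reindex (cons_path i)) /=; last first.
  exists tail_path => [q _|p].
    by apply/ffunP => k; rewrite !ffunE liftK.
  rewrite inE => /eqP p0; apply/ffunP => k; rewrite !ffunE.
  by case: unliftP => [j ->|->] //=; rewrite ffunE.
rewrite (eq_bigl xpredT); last by move=> q; rewrite ffunE unlift_none eqxx.
rewrite (partition_big (fun q : {ffun 'I_l.+1 -> 'I_N} => q ord0) xpredT)//=.
apply: eq_bigr => j _; rewrite /beta big_distrr /=.
apply: eq_bigr => q /eqP q0; rewrite big_ord_recl /=; congr (_ * _).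
  have -> : widen_ord (leqnSn l.+1) ord0 = ord0 by apply/val_inj.
  by rewrite !ffunE unlift_none liftK /= q0.
apply: eq_bigr => k _; rewrite !ffunE liftK /=.
have -> : widen_ord (leqnSn l.+1) (lift ord0 k) = lift ord0 (widen_ord (leqnSn l) k).
  exact/val_inj.
by rewrite liftK.
Qed.

Hypothesis Wsym : forall i j, W i j = W j i.

(** As a vector, [beta W _ l] is [W^l 1]. The induction moves one factor [W] at a time across the
    inner product, by symmetry. *)
Lemma sum_beta_mul l1 l2 :
  \sum_i beta W i l1 * beta W i l2 = \sum_i beta W i (l1 + l2).
Proof.
elim: l1 l2 => [|l1 IH] l2.
  by apply: eq_bigr => i _; rewrite beta0 mul1r.
rewrite addSnnS -IH.
under eq_bigr do rewrite betaS mulr_suml.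
rewrite exchange_big /=; apply: eq_bigr => j _.
rewrite betaS mulr_sumr; apply: eq_bigr => i _.
by rewrite Wsym mulrCA mulrA.
Qed.

Lemma sum_beta_double_ge0 n : 0 <= \sum_i beta W i (n + n).
Proof. by rewrite -sum_beta_mul sumr_ge0// => i _; rewrite -expr2 sqr_ge0. Qed.

End beta_theory.

(** All paths have nonnegative weight; only the one that stays at [i] is kept. *)
Lemma beta_ge (R : realType) (N : nat) (W : 'I_N -> 'I_N -> R) (K : R) i l :
  0 <= K -> (forall i j, K <= W i j) -> K ^+ l <= beta W i l.
Proof.
move=> K0 KW; elim: l i => [|l IH] i; first by rewrite beta0 expr0.
rewrite betaS (bigD1 i)//= exprS.
have Kl : 0 <= K ^+ l by rewrite exprn_ge0.
rewrite -[leLHS]addr0 lerD ?ler_pM//.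
apply: sumr_ge0 => j _; rewrite mulr_ge0//; first exact: le_trans (KW _ _).
exact: le_trans (IH j).
Qed.

(** * Eigenvalues *)

Lemma seqmax_ge (R : realType) (s : seq R) x : x \in s -> x <= seqmax s.
Proof.
rewrite /seqmax; move: (head 0 s) => y; elim: s => //= a s IH.
rewrite inE le_max => /orP[/eqP->|/IH ->]; first by rewrite lexx.
by rewrite orbT.
Qed.

(** The fold is seeded with the head of [s], so no foreign value enters the maximum. *)
Lemma mem_seqmax (R : realType) (s : seq R) : s != [::] -> seqmax s \in s.
Proof.
case: s => // a s _; rewrite /seqmax /=.
have : foldr Num.max a s \in a :: s.
  elim: s => /= [|b s IH]; first by rewrite inE.
  rewrite /Num.max; case: ifP => _; last by rewrite !inE eqxx ?orbT.
  by move: IH; rewrite !inE => /orP[->//|->]; rewrite !orbT.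
by rewrite /Num.max; case: ifP => // _ _; exact: mem_head.
Qed.

Section eigenvalues.
Variables (F : fieldType) (n : nat) (A : 'M[F]_n.+1) (s : seq F).
Hypothesis As : char_poly A = \prod_(x <- s) ('X - x%:P).

Lemma size_eigenvalues : size s = n.+1.
Proof. by apply: succn_inj; rewrite -(size_prod_XsubC _ id) -As size_char_poly. Qed.

Lemma sum_eigenvalues : \sum_(x <- s) x = \tr A.
Proof.
apply: oppr_inj; rewrite -char_poly_trace// As.
by rewrite -size_eigenvalues coefPn_prod_XsubC// size_eigenvalues.
Qed.

End eigenvalues.

(* With [p = char_poly A], the determinant of [X^2 - A^2 = (X - A) (X + A)] is
   [p(X) p(-X)] up to sign. *)
Lemma char_poly_sqr (F : fieldType) n (A : 'M[F]_n.+1) s :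
  char_poly A = \prod_(x <- s) ('X - x%:P) ->
  char_poly (A *m A) = \prod_(x <- [seq x ^+ 2 | x <- s]) ('X - x%:P).
Proof.
move=> As; have sz := size_eigenvalues As.
(* The factorisation lives in the variable [X^2], and substituting [X^2] for [X] is injective. *)
have comp_inj (p q : {poly F}) : p \Po 'X^2 = q \Po 'X^2 -> p = q.
  move=> pq; apply/polyP => i.
  have := congr1 (fun r : {poly F} => r`_(i * 2)) pq.
  by rewrite !coef_comp_poly_Xn// dvdn_mull// mulnK.
(* Substitute [-X] in the hypothesis: both sides acquire the sign [(-1) ^+ n.+1], which cancels. *)
have charN : \det ('X%:M + map_mx polyC A) = \prod_(x <- s) ('X + x%:P).
  have e : char_poly A \Po (- 'X) = (-1) ^+ n.+1 * \det ('X%:M + map_mx polyC A).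
    rewrite /char_poly -det_map_mx -detZ; congr (\det _).
    apply/matrixP => i j; rewrite !mxE rmorphB rmorphMn /= comp_polyX comp_polyC.
    by rewrite mulN1r opprD mulNrn.
  have prodN t : (\prod_(x <- t) ('X - x%:P)) \Po (- 'X)
      = (-1) ^+ size t * \prod_(x <- t) ('X + x%:P) :> {poly F}.
    rewrite rmorph_prod /=; elim: t => [|x t IH]; first by rewrite !big_nil mulr1.
    by rewrite !big_cons IH /= rmorphB /= comp_polyX comp_polyC exprS; ring.
  move: e; rewrite As prodN sz => /(congr1 (fun q => (-1) ^+ n.+1 * q)).
  by rewrite !mulrA -!expr2 sqrr_sign !mul1r.
apply: comp_inj; rewrite rmorph_prod /= big_map.
have -> : char_poly (A *m A) \Po 'X^2
    = char_poly A * \det ('X%:M + map_mx polyC A).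
  rewrite /char_poly -det_map_mx -det_mulmx; congr (\det _).
  rewrite mulmxBl !mulmxDr (scalar_mxC 'X (map_mx polyC A)) opprD addrA addrK.
  rewrite -map_mxM -scalar_mxM.
  apply/matrixP => i j; rewrite !mxE rmorphB rmorphMn /= comp_polyX comp_polyC.
  by rewrite expr2.
rewrite As charN -big_split /=; apply: eq_bigr => x _.
by rewrite rmorphB /= comp_polyX comp_polyC -subr_sqr rmorphXn.
Qed.

(** * Spectral bounds for positive semidefinite matrices *)

Section psd.
Variables (R : realType) (n : nat) (A : 'M[R]_n.+1) (s : seq R).
Hypothesis As : char_poly A = \prod_(x <- s) ('X - x%:P).
Hypothesis Asym : forall i j, A i j = A j i.
Hypothesis Apsd : forall x : 'I_n.+1 -> R, 0 <= \sum_i \sum_j x i * x j * A i j.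

(** At a left eigenvector [v] the quadratic form equals [a] times the squared norm of [v]. *)
Lemma psd_eigenvalue_ge0 a : a \in s -> 0 <= a.
Proof.
move=> sa; have : eigenvalue A a by rewrite eigenvalue_root_char As root_prod_XsubC.
move=> /eigenvalueP[v vA v0].
have v2 : 0 < \sum_i v 0 i ^+ 2.
  rewrite lt_def sumr_ge0 ?andbT; last by move=> i _; exact: sqr_ge0.
  apply: contra v0; rewrite psumr_eq0 => [/allP v0|i _]; last exact: sqr_ge0.
  apply/eqP/rowP => i; rewrite mxE; apply/eqP.
  by have := v0 i (mem_index_enum _); rewrite sqrf_eq0.
have := Apsd (v 0); rewrite exchange_big /=.
have -> : \sum_j \sum_i v 0 i * v 0 j * A i j = a * \sum_i v 0 i ^+ 2.
  rewrite mulr_sumr; apply: eq_bigr => j _.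
  rewrite expr2 mulrA; have := congr1 (fun u : 'rV_n.+1 => u 0 j) vA.
  rewrite !mxE => <-; rewrite mulr_suml; apply: eq_bigr => i _; ring.
by rewrite pmulr_lge0.
Qed.

Lemma seqmax_le_trace : seqmax s <= \tr A.
Proof.
have sN : s != [::] by rewrite -size_eq0 (size_eigenvalues As).
rewrite -(sum_eigenvalues As) (big_rem _ (mem_seqmax sN)) /= lerDl.
by rewrite big_seq sumr_ge0// => x /mem_rem; exact: psd_eigenvalue_ge0.
Qed.

(** Both sides are compared with [\tr (A *m A)]: it is the sum of the squares of all entries, and
    also the sum of the squared eigenvalues. *)
Lemma sqr_diag_le_seqmax k : A k k ^+ 2 <= seqmax s * \tr A.
Proof.
have tr2 : \tr (A *m A) <= seqmax s * \tr A.
  rewrite -(sum_eigenvalues (char_poly_sqr As)) -(sum_eigenvalues As).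
  rewrite big_map mulr_sumr [leLHS]big_seq [leRHS]big_seq ler_sum// => x xs.
  by rewrite expr2 ler_wpM2r// ?psd_eigenvalue_ge0 ?seqmax_ge.
apply: le_trans tr2; rewrite /mxtrace (bigD1 k)//= mxE (bigD1 k)//= -expr2 -addrA.
rewrite lerDl addr_ge0// sumr_ge0// => i _; rewrite ?mxE ?sumr_ge0// => *;
  by rewrite 1?Asym -expr2 sqr_ge0.
Qed.

End psd.

(** * Log-convex sequences *)

Section log_convex.
Variables (R : realType) (a : nat -> R).
Hypothesis a_gt0 : forall n, 0 < a n.
Hypothesis a_logconvex : forall n, a n.+1 ^+ 2 <= a n * a n.+2.
Hypothesis a_superexp :
  forall K : R, 0 < K -> exists2 c : R, 0 < c & forall n, c * K ^+ n <= a n.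

Let r n := a n.+1 / a n.

Let r_le m n : (m <= n)%N -> r m <= r n.
Proof.
elim: n => [|n IH]; first by rewrite leqn0 => /eqP ->.
rewrite leq_eqVlt => /predU1P[->//|]; rewrite ltnS => /IH /le_trans; apply.
rewrite /r ler_pdivrMr// mulrAC ler_pdivlMr// -expr2 mulrC; exact: a_logconvex.
Qed.

Let a_le M n : (forall k, r k <= M) -> a n <= a 0 * M ^+ n.
Proof.
move=> rM; elim: n => [|n IH]; first by rewrite mulr1.
have M0 : 0 <= M by apply: le_trans (rM 0%N); rewrite divr_ge0// ltW.
have := rM n; rewrite /r ler_pdivrMr// => /le_trans; apply.
by rewrite exprS mulrCA ler_wpM2l.
Qed.

(** The ratios are nondecreasing, so it suffices to exceed [M] once. Bounded ratios would make [a]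
    at most geometric, against [a_superexp]. *)
Lemma log_convex_ratio_unbounded M : exists n, forall k, (n <= k)%N -> M <= r k.
Proof.
suff [n Mn] : exists n, M <= r n by exists n => k nk; exact: le_trans (r_le nk).
apply/not_existsP => H.
pose L := Num.max M 1.
have L0 : 0 < L by rewrite lt_max ltr01 orbT.
have rL k : r k <= L.
  by have /negP := H k; rewrite -ltNge => /ltW h; rewrite le_max h.
(* The rate [2 * L] leaves [c * 2 ^+ n <= a 0] after cancelling [L ^+ n], which fails for large
   [n]. *)
have [|c c0 ca] := a_superexp (K := 2 * L); first by rewrite mulr_gt0.
have two n : c * 2 ^+ n <= a 0.
  have := le_trans (ca n) (a_le n rL).
  by rewrite exprMn mulrA ler_pM2r// exprn_gt0.
have [n] : exists n, a 0 / c < n%:R :> R.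
  by exists (Num.bound (a 0 / c)); apply: archi_boundP; rewrite divr_ge0// ltW.
rewrite ltr_pdivrMr// mulrC => h.
suff : c * n%:R <= c * 2 ^+ n by move/(lt_le_trans h); rewrite ltNge two.
by rewrite ler_pM2l// -natrX ler_nat ltnW// ltn_expl.
Qed.

(** The earlier terms relative to [a n], called [s n], satisfy [s n.+1 = (s n + 1) / r n]. They stay
    bounded once [r] is at least 2, and then tend to 0 because [r] is unbounded. *)
Lemma log_convex_sum_equiv : (fun n => (\sum_(l < n.+1) a l) / a n) @ \oo --> (1 : R).
Proof.
pose s n := (\sum_(l < n) a l) / a n.
have sE n : (\sum_(l < n.+1) a l) / a n = s n + 1.
  by rewrite big_ord_recr /= mulrDl divff ?gt_eqF.
have sS n : s n.+1 = (s n + 1) / r n.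
  by rewrite -sE /s /r invf_div; field; rewrite ?gt_eqF.
have s0 n : 0 <= s n by rewrite divr_ge0 ?sumr_ge0// => *; exact: ltW.
have r0 n : 0 < r n by rewrite divr_gt0.
have [n0 n0r] := log_convex_ratio_unbounded 2.
(* Taking [C] at least 1 gives [(C + 1) / 2 <= C], so the bound propagates through the recursion. *)
pose C := Num.max (s n0) 1.
have C1 : 1 <= C by rewrite le_max lexx orbT.
have sC k : s (n0 + k)%N <= C.
  elim: k => [|k IH]; first by rewrite addn0 le_max lexx.
  rewrite addnS sS ler_pdivrMr//.
  have := n0r (n0 + k)%N (leq_addr _ _); nra.
apply/cvgrPdist_le => e e0.
have [n1 n1r] := log_convex_ratio_unbounded ((C + 1) / e).
exists (n0 + n1).+1 => //= -[//|n] /=; rewrite ltnS => nn.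
rewrite sE opprD addrCA subrr addr0 normrN ger0_norm// sS.
have nn0 : (n0 <= n)%N by apply: leq_trans nn; rewrite leq_addr.
have nn1 : (n1 <= n)%N by apply: leq_trans nn; rewrite leq_addl.
have := sC (n - n0)%N; rewrite subnKC// => sn.
have := n1r _ nn1; rewrite !ler_pdivrMr// => rn.
rewrite mulrC; apply: le_trans rn; lra.
Qed.

(** The squeezes are [(a / t)^2 <= L / t <= 1] and [a / t <= L / a <= t / a]. Here [t] stands for
    the trace and [L] for the largest eigenvalue. *)
Lemma log_convex_squeeze (t L : nat -> R) :
  (forall n, t n = \sum_(l < n.+1) a l) ->
  (forall n, L n <= t n) -> (forall n, a n ^+ 2 <= L n * t n) ->
  (fun n => L n / t n) @ \oo --> (1 : R) /\ (fun n => L n / a n) @ \oo --> (1 : R).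
Proof.
move=> tE Lt aL.
have ta : (fun n => t n / a n) @ \oo --> (1 : R).
  by under eq_fun do rewrite tE; exact: log_convex_sum_equiv.
have t0 n : 0 < t n.
  rewrite tE big_ord_recr/= ltr_wpDl// sumr_ge0// => *; exact: ltW.
have at1 : (fun n => a n / t n) @ \oo --> (1 : R).
  rewrite (_ : (fun _ => _) = (fun n => (t n / a n)^-1)).
    by rewrite -[X in _ --> X]invr1; apply: cvgV => //; exact: oner_neq0.
  by apply/funext => n; rewrite invf_div.
split.
- have at2 : (fun n => (a n / t n) * (a n / t n)) @ \oo --> (1 : R).
    by rewrite -[X in _ --> X]mulr1; exact: cvgM.
  apply: (squeeze_cvgr _ at2 (cvg_cst _)); near=> n.
  rewrite ler_pdivrMr// mul1r Lt andbT ler_pdivlMr//.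
  by rewrite mulrA divfK ?gt_eqF// mulrAC ler_pdivrMr// -expr2.
- apply: (squeeze_cvgr _ at1 ta); near=> n.
  rewrite ler_pM2r ?invr_gt0// Lt andbT ler_pdivlMr// mulrAC ler_pdivrMr// -expr2.
  exact: aL.
Unshelve. all: by end_near. Qed.

End log_convex.

(** * Integrability and Gaussian tails *)

Section finite_moments.
Context d (T : measurableType d) (R : realType) (P : probability T R).
Implicit Types f g : T -> R.

Lemma le_integrable_EFin f g : measurable_fun setT f ->
  (forall w, `|f w| <= g w) -> P.-integrable setT (EFin \o g) ->
  P.-integrable setT (EFin \o f).
Proof.
move=> mf fg; apply: le_integrable => //; first exact/measurable_EFinP.
move=> w _ /=; rewrite lee_fin [leRHS]ger0_norm//.
exact: le_trans (fg w).
Qed.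

(** Asking for all orders at once makes the class stable under products, hence under polynomials in
    the entries of [W]. *)
Definition finite_moments f := measurable_fun setT f /\
  forall k, P.-integrable setT (EFin \o (fun w => `|f w| ^+ k)).

Let measurable_normX f k : measurable_fun setT f ->
  measurable_fun setT (fun w => `|f w| ^+ k).
Proof. by move=> mf; apply: measurable_funX; exact: measurableT_comp. Qed.

Lemma finite_moments_integrable f :
  finite_moments f -> P.-integrable setT (EFin \o f).
Proof. by case=> mf /(_ 1%N); exact: le_integrable_EFin. Qed.

Lemma finite_moments_cst c : finite_moments (cst c).
Proof.
split=> [|k]; first exact: measurable_cst.
exact: (finite_measure_integrable_cst P (`|c| ^+ k)).
Qed.

Lemma finite_momentsD f g :
  finite_moments f -> finite_moments g -> finite_moments (f \+ g).
Proof.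
move=> [mf If] [mg Ig]; split=> [|k]; first exact: measurable_funD.
have I : P.-integrable setT
    (EFin \o (fun w => 2 ^+ k * (`|f w| ^+ k + `|g w| ^+ k))).
  have := integrableZl measurableT (2 ^+ k) (integrableD measurableT (If k) (Ig k)).
  by apply: eq_integrable => // w _ /=; rewrite EFinM.
apply: le_integrable_EFin I; first by apply: measurable_normX; exact: measurable_funD.
move=> w /=; rewrite ger0_norm ?exprn_ge0//.
(* Pointwise, the sum is at most twice the larger of the two absolute values. *)
wlog fg : f g {mf If mg Ig} / `|f w| <= `|g w|.
  move=> H; have [|/ltW] := leP `|f w| `|g w|; first exact: H.
  by move=> /H; rewrite addrC [X in _ * X]addrC.
apply: (@le_trans _ _ ((2 * `|g w|) ^+ k)).
  rewrite lerXn2r ?nnegrE ?mulr_ge0//.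
  by rewrite (le_trans (ler_normD _ _))// mulr_natl mulr2n lerD2r.
by rewrite exprMn ler_wpM2l ?exprn_ge0// lerDr exprn_ge0.
Qed.

(** With [a] and [b] the [k]-th powers of the absolute values, [a * b <= a^2 + b^2] reduces order
    [k] of the product to order [2k] of the factors. *)
Lemma finite_momentsM f g :
  finite_moments f -> finite_moments g -> finite_moments (f \* g).
Proof.
move=> [mf If] [mg Ig]; split=> [|k]; first exact: measurable_funM.
have I := integrableD measurableT (If (k * 2)%N) (Ig (k * 2)%N).
apply: (@le_integrable_EFin _ (fun w => `|f w| ^+ (k * 2) + `|g w| ^+ (k * 2))) I.
  by apply: measurable_normX; exact: measurable_funM.
move=> w /=; rewrite ger0_norm ?exprn_ge0// normrM exprMn !exprM.
have : 0 <= `|f w| ^+ k by rewrite exprn_ge0.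
have : 0 <= `|g w| ^+ k by rewrite exprn_ge0.
move: (_ ^+ k) (_ ^+ k) => a b; nra.
Qed.

Lemma finite_moments_sum (I : Type) (s : seq I) (h : I -> T -> R) :
  (forall i, finite_moments (h i)) -> finite_moments (fun w => \sum_(i <- s) h i w).
Proof.
move=> fh; elim: s => [|i s IH].
  by under eq_fun do rewrite big_nil; exact: finite_moments_cst.
by under eq_fun do rewrite big_cons; exact: finite_momentsD.
Qed.

Lemma Rintegral_finite_sum (I : finType) (h : I -> T -> R) :
  (forall i, finite_moments (h i)) ->
  \int[P]_w (\sum_i h i w) = \sum_i \int[P]_w h i w.
Proof.
move=> fh; elim: (index_enum I) => [|i s IH].
  under eq_Rintegral do rewrite big_nil.
  by rewrite big_nil Rintegral_cst// mul0r.
under eq_Rintegral do rewrite big_cons.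
rewrite big_cons RintegralD ?IH//; first exact: finite_moments_integrable.
exact/finite_moments_integrable/finite_moments_sum.
Qed.

End finite_moments.

(** * Moments and tails of the normal law *)

Section normal.
Variables (R : realType) (m s : R).
Notation mu := (@lebesgue_measure R).

(** The Radon-Nikodym derivative of [normal_prob] agrees almost everywhere with [normal_pdf], since
    both have the same integral over every measurable set. *)
Lemma ge0_integral_normal_prob (f : R -> \bar R) :
  measurable_fun setT f -> (forall x, 0 <= f x)%E ->
  (\int[normal_prob m s]_x f x = \int[mu]_x (f x * (normal_pdf m s x)%:E))%E.
Proof.
move=> mf f0.
have dom := normal_prob_dominates m s.
have mpdf : measurable_fun setT (EFin \o normal_pdf m s).
  by apply/measurable_EFinP; apply: measurable_normal_pdf.
rewrite -(Radon_Nikodym_SigmaFinite.change_of_variables dom)//.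
have mRN := measurable_int _ (Radon_Nikodym_SigmaFinite.f_integrable dom).
apply: ae_eq_integral => //; [exact: emeasurable_funM..|].
apply: ae_eqe_mul2l; apply: integral_ae_eq => //.
  exact: Radon_Nikodym_SigmaFinite.f_integrable.
by move=> E _ mE; rewrite -Radon_Nikodym_SigmaFinite.f_integral.
Qed.

End normal.

(** One term of the exponential series controls [|x|^(2k+2)]; the summand 1 in the constant covers
    [|x| <= 1]. *)
Lemma normX_le_expR (R : realType) (c : R) k : 0 < c ->
  exists2 C, 0 <= C & forall x, `|x| ^+ k <= C * expR (c * x ^+ 2).
Proof.
move=> c0; exists (1 + k.+1`!%:R / c ^+ k.+1 : R).
  by rewrite addr_ge0// divr_ge0// exprn_ge0// ltW.
move=> x; have y0 : 0 <= c * x ^+ 2 by rewrite mulr_ge0 ?sqr_ge0// ltW.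
have e1 : 1 <= expR (c * x ^+ 2) by rewrite -[leLHS]expR0 ler_expR.
have ek : `|x| ^+ (2 * k.+1) <= k.+1`!%:R / c ^+ k.+1 * expR (c * x ^+ 2).
  have := expR_ge1Dxn k y0; rewrite exprMn -[x ^+ 2]real_normK ?num_real// -exprM.
  set e := expR _ => h.
  have f0 : 0 < k.+1`!%:R :> R by rewrite ltr0n fact_gt0.
  have ck : 0 < c ^+ k.+1 by rewrite exprn_gt0.
  rewrite mulrAC ler_pdivlMr// -ler_pdivrMl//.
  by apply: le_trans h; rewrite mulrC [_ * c ^+ _]mulrC lerDr.
rewrite mulrDl mul1r.
have [x1|x1] := leP `|x| 1.
  have : `|x| ^+ k <= 1 by rewrite exprn_ile1.
  have : 0 <= `|x| ^+ (2 * k.+1) by rewrite exprn_ge0.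
  by move: ek; lra.
have : `|x| ^+ k <= `|x| ^+ (2 * k.+1) by rewrite ler_weXn2l ?ltW// mul2n -addnn; lia.
by move: ek; lra.
Qed.

(** Doubling the standard deviation absorbs the polynomial weight, leaving an integrable density as
    dominating function. *)
Lemma normX_normal_pdf_le (R : realType) (s : R) k : s != 0 ->
  exists2 K, 0 <= K &
    forall x, `|x| ^+ k * normal_pdf 0 s x <= K * normal_pdf 0 (2 * s) x.
Proof.
move=> s0; have s2 : 0 < s ^+ 2 by rewrite exprn_even_gt0.
(* The exponents of the two densities are [- x^2 / (2 s^2)] and [- x^2 / (8 s^2)]. *)
have [|C C0 HC] := @normX_le_expR R (3 / (8 * s ^+ 2)) k.
  by rewrite divr_gt0// mulr_gt0.
have s0' : 2 * s != 0 by rewrite mulf_neq0.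
have p1 := normal_peak_ge0 s.
have p2 := normal_peak_gt0 s0'.
exists (normal_peak s * C / normal_peak (2 * s)).
  by rewrite divr_ge0 ?mulr_ge0// ltW.
move=> x; rewrite !normal_pdfE//.
(* The coefficient comes from [1/2 - 1/8 = 3/8]. *)
have e : expR (3 / (8 * s ^+ 2) * x ^+ 2) * normal_fun 0 s x = normal_fun 0 (2 * s) x.
  rewrite /normal_fun -expRD; congr expR.
  by rewrite !subr0; field.
have : `|x| ^+ k * normal_fun 0 s x <= C * normal_fun 0 (2 * s) x.
  by rewrite -e mulrA ler_wpM2r ?normal_fun_ge0.
move: (normal_fun 0 s x) (normal_fun 0 (2 * s) x) => f1 f2 {e HC}.
move: (normal_peak s) (normal_peak (2 * s)) p1 p2 => p q p0 q0 h.
have -> : p * C / q * (q * f2) = p * (C * f2) by field; rewrite gt_eqF.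
by rewrite mulrCA ler_wpM2l.
Qed.

Lemma normal_prob_normX_lty (R : realType) (s : R) k : s != 0 ->
  (\int[normal_prob 0 s]_x (`|x| ^+ k)%:E < +oo)%E.
Proof.
move=> s0.
have mX : measurable_fun setT (fun x : R => `|x| ^+ k).
  by apply: measurable_funX.
have mpdf (t : R) : measurable_fun setT (normal_pdf 0 t).
  by apply: measurable_normal_pdf.
rewrite ge0_integral_normal_prob; [|exact/measurable_EFinP|]; last first.
  by move=> x; rewrite lee_fin exprn_ge0.
have [K K0 HK] := normX_normal_pdf_le k s0.
have m1 : measurable_fun setT (fun x : R => (`|x| ^+ k)%:E * (normal_pdf 0 s x)%:E)%E.
  by apply: emeasurable_funM; exact/measurable_EFinP.
have m2 : measurable_fun setT (fun x : R => K%:E * (normal_pdf 0 (2 * s) x)%:E)%E.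
  by apply: emeasurable_funM => //; exact/measurable_EFinP.
apply: (@le_lt_trans _ _
  (\int[lebesgue_measure]_x (K%:E * (normal_pdf 0 (2 * s) x)%:E))%E).
  apply: ge0_le_integral => //.
  - by move=> x _; rewrite -EFinM lee_fin mulr_ge0 ?exprn_ge0 ?normal_pdf_ge0.
  - by move=> x _; rewrite -!EFinM lee_fin.
rewrite ge0_integralZl//.
- by rewrite integral_normal_pdf mule1 ltry.
- have m3 : measurable_fun setT (EFin \o normal_pdf 0 (2 * s)) by exact/measurable_EFinP.
  exact: m3.
- by move=> x _; rewrite lee_fin normal_pdf_ge0.
Qed.

Lemma normal_prob_tail_gt0 (R : realType) (s K : R) : s != 0 -> 0 <= K ->
  (0 < normal_prob 0 s `[K, +oo[)%E.
Proof.
move=> s0 K0; rewrite /normal_prob.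
(* The density decreases on the nonnegative axis, so [e] is its minimum on [I], an interval of
   length 1. *)
pose e := normal_pdf 0 s (K + 1); pose I : set R := `[K, (K + 1)%R]%classic.
have mI : measurable I by exact: measurable_itv.
have e0 : 0 < e by rewrite /e normal_pdfE// mulr_gt0 ?expR_gt0 ?normal_peak_gt0.
have mpdf (D : set R) : measurable_fun D (EFin \o normal_pdf 0 s).
  by apply: measurable_funTS; apply/measurable_EFinP; apply: measurable_normal_pdf.
apply: (@lt_le_trans _ _ (\int[lebesgue_measure]_(x in I) e%:E)%E).
  rewrite integral_cst /=; last exact: mI.
  rewrite lebesgue_measure_itv /= lte_fin ltrDl ltr01.
  by rewrite -EFinD -EFinM lte_fin addrAC subrr add0r mulr1.
apply: (@le_trans _ _ (\int[lebesgue_measure]_(x in I) (normal_pdf 0 s x)%:E)%E).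
  apply: ge0_le_integral => //=.
  - by move=> x _; rewrite lee_fin ltW.
  - exact: mpdf.
  move=> x; rewrite /I /= in_itv /= => /andP[Kx xK].
  rewrite lee_fin /e !normal_pdfE// ler_wpM2l ?normal_peak_ge0// ler_expR.
  rewrite !subr0 ler_pM2r ?invr_gt0 ?pmulrn_lgt0 ?exprn_even_gt0// lerN2.
  by rewrite lerXn2r// nnegrE; lra.
apply: ge0_subset_integral => //=.
- exact: mpdf.
- by move=> x _; rewrite lee_fin normal_pdf_ge0.
- by move=> x; rewrite /I /= !in_itv /= => /andP[->].
Qed.

Lemma gaussian_finite_moments d (T : measurableType d) (R : realType)
    (P : probability T R) (s : R) (X : {RV P >-> R}) : s != 0 ->
  (forall A : set R, measurable A -> distribution P X A = normal_prob 0 s A) ->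
  finite_moments P X.
Proof.
move=> s0 XN; split=> [|k]; first exact: measurable_funPT.
have mX : measurable_fun setT (fun x : R => `|x| ^+ k).
  by apply: measurable_funX.
apply/integrableP; split.
  by apply/measurable_EFinP; apply: (measurableT_comp mX); exact: measurable_funPT.
under eq_integral do rewrite /= ger0_norm ?exprn_ge0//.
(* [normal_prob] lives on [measurableTypeR R], the random variables on [R] with its
   default display: both carry the Borel sigma-algebra. *)
pose Y : T -> measurableTypeR R := X.
have mY : measurable_fun setT Y by exact: (@measurable_funPT _ _ _ _ X).
have mf : measurable_fun setT (fun y : measurableTypeR R => (`|y| ^+ k)%:E).
  by have /measurable_EFinP := mX.
have -> : (\int[P]_w (`|X w| ^+ k)%:E = \int[pushforward P Y]_y (`|y| ^+ k)%:E)%E.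
  by rewrite (ge0_integral_pushforward mY)// => y _; rewrite lee_fin exprn_ge0.
apply: le_lt_trans (normal_prob_normX_lty k s0).
rewrite le_eqVlt; apply/orP; left; apply/eqP.
by apply: eq_measure_integral => A mA _; exact: XN.
Qed.

(** * The moment sequence *)

Section random_matrix.
Context d (Omega : measurableType d) (R : realType) (P : probability Omega R).
Variables (N : nat) (W : 'I_N -> 'I_N -> {RV P >-> R}).
Hypothesis Wsym : forall i j, W i j = W j i.
Hypothesis Wmoments : forall i j, finite_moments P (W i j).

Let b w i l := beta (fun i j => W i j w) i l.

Definition moment k : R := \int[P]_w \sum_i b w i k.

Let symW w i j : W i j w = W j i w. Proof. by rewrite Wsym. Qed.

Lemma finite_moments_beta i l : finite_moments P (fun w => b w i l).
Proof.
elim: l i => [|l IH] i.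
  by rewrite /b; under eq_fun do rewrite beta0; exact: finite_moments_cst.
rewrite /b; under eq_fun do rewrite betaS.
by apply: finite_moments_sum => j; exact: (finite_momentsM (Wmoments i j) (IH j)).
Qed.

Lemma finite_moments_sum_beta k : finite_moments P (fun w => \sum_i b w i k).
Proof. by apply: finite_moments_sum => i; exact: finite_moments_beta. Qed.

Lemma moments_matrixE T (l1 l2 : 'I_T.+1) :
  moments_matrix W T l1 l2 = moment (l1 + l2).
Proof.
rewrite mxE unlock /moment /Rintegral; congr fine; apply: eq_integral => w _.
by rewrite sum_beta_mul.
Qed.

(** The form is the expectation of a sum of squares. The free index family [l] serves both the whole
    matrix and the two-row minors behind log-convexity. *)
Lemma moment_psd (I : finType) (l : I -> nat) (x : I -> R) :
  0 <= \sum_i \sum_j x i * x j * moment (l i + l j).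
Proof.
have fm i j : finite_moments P (fun w => x i * x j * \sum_a b w a (l i + l j)).
  exact: (finite_momentsM (finite_moments_cst P _) (finite_moments_sum_beta _)).
have -> : \sum_i \sum_j x i * x j * moment (l i + l j) =
    \int[P]_w \sum_i \sum_j x i * x j * \sum_a b w a (l i + l j).
  rewrite Rintegral_finite_sum//; last first.
    by move=> i; apply: finite_moments_sum.
  apply: eq_bigr => i _; rewrite Rintegral_finite_sum//.
  apply: eq_bigr => j _; rewrite RintegralZl//.
  exact/finite_moments_integrable/finite_moments_sum_beta.
apply: Rintegral_ge0 => w _.
have -> : \sum_i \sum_j x i * x j * (\sum_a b w a (l i + l j)) =
    \sum_a (\sum_i x i * b w a (l i)) ^+ 2.
  under [RHS]eq_bigr do rewrite expr2 big_distrlr.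
  rewrite [RHS]exchange_big; apply: eq_bigr => i _.
  rewrite [RHS]exchange_big; apply: eq_bigr => j _.
  rewrite /b -sum_beta_mul// mulr_sumr; apply: eq_bigr => a _; exact: mulrACA.
by apply: sumr_ge0 => a _; exact: sqr_ge0.
Qed.

Lemma moment_logconvex n : 0 < moment (n + n) ->
  moment (n.+1 + n.+1) ^+ 2 <= moment (n + n) * moment (n.+2 + n.+2).
Proof.
move=> a0; pose t := moment (n.+1 + n.+1).
(* On the rows [n] and [n.+2] this vector makes the form equal to [moment (n + n)] times the
   difference of the two sides of the goal. *)
have := @moment_psd bool (fun c => if c then n else n.+2)
  (fun c => if c then t else - moment (n + n)).
rewrite !big_bool /=.
have -> : (n + n.+2 = n.+1 + n.+1)%N by lia.
have -> : (n.+2 + n = n.+1 + n.+1)%N by lia.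
rewrite -/t => h; rewrite -subr_ge0 -(pmulr_rge0 _ a0).
by apply: le_trans h _; rewrite le_eqVlt; apply/orP; left; apply/eqP; ring.
Qed.

(** The even-order integrand is nonnegative everywhere, so the integral may be restricted to [E];
    there a single starting vertex suffices. *)
Lemma moment_ge (E : set Omega) K n : (0 < N)%N -> 0 <= K -> measurable E ->
  (forall w, E w -> forall i j, K <= W i j w) ->
  K ^+ (n + n) * fine (P E) <= moment (n + n).
Proof.
move=> N0 K0 mE EW.
have -> : K ^+ (n + n) * fine (P E) = \int[P]_w (K ^+ (n + n) * \1_E w).
  rewrite RintegralZl//; last exact: integrable_indic.
  by rewrite /Rintegral integral_indic// setIT.
apply: le_Rintegral => //.
- have := integrableZl measurableT (K ^+ (n + n)) (integrable_indic P mE).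
  by apply: eq_integrable => // w _ /=; rewrite EFinM.
- exact/finite_moments_integrable/finite_moments_sum_beta.
move=> w _; rewrite indicE; have [/set_mem wE|_] := boolP (w \in E); last first.
  by rewrite mulr0; exact: sum_beta_double_ge0.
have KW := EW w wE.
rewrite mulr1 (bigD1 (Ordinal N0))//= -[leLHS]addr0 lerD ?sumr_ge0//.
- exact: beta_ge.
- by move=> i _; apply: le_trans (beta_ge i _ K0 KW); rewrite exprn_ge0.
Qed.

End random_matrix.

Unset Implicit Arguments.

Theorem mainTheorem10 (d : measure_display) (Omega : measurableType d)
  (R : realType) (P : probability Omega R) (N : nat) (hN : (0 < N)%N)
  (sigma : R) (hsigma : 0 < sigma)
  (W : 'I_N -> 'I_N -> {RV P >-> R})
  (Wsym : forall i j, W i j = W j i)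
  (Wgauss : forall i j : 'I_N, (i <= j)%N -> forall A : set R, measurable A ->
      distribution P (W i j) A = normal_prob 0 sigma A)
  (Windep : mutually_independent [pred ij : 'I_N * 'I_N | (ij.1 <= ij.2)%N]
              (fun ij => W ij.1 ij.2))
  (lam : nat -> seq R)
  (hlam : forall T : nat, char_poly (moments_matrix W T)
                          = \prod_(x <- lam T) ('X - x%:P)) :
  (fun T => seqmax (lam T) / \sum_(x <- lam T) x) @ \oo --> (1 : R) /\
  (fun T => seqmax (lam T) / moments_matrix W T ord_max ord_max) @ \oo --> (1 : R).
Proof.
have s0 : sigma != 0 by rewrite gt_eqF.
have Wlaw i j A : measurable A -> distribution P (W i j) A = normal_prob 0 sigma A.
  by move=> mA; have [ij|/ltnW ji] := leqP i j; [|rewrite Wsym]; exact: Wgauss.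
have Wmoments i j : finite_moments P (W i j).
  by apply: (gaussian_finite_moments s0) => A; exact: Wlaw.
pose a n := moment W (n + n).
have superexp K : 0 < K -> exists2 c, 0 < c & forall n, c * K ^+ n <= a n.
  (* The moment of order [2n] yields [L ^+ (n + n)]; since [L] is at least both 1 and [K], this
     dominates [K ^+ n]. *)
  move=> K0; pose L := Num.max K 1.
  have L1 : 1 <= L by rewrite le_max lexx orbT.
  have KL : K <= L by rewrite le_max lexx.
  have L0 : 0 <= L by exact: le_trans L1.
  pose S := [pred ij : 'I_N * 'I_N | (ij.1 <= ij.2)%N].
  pose E := \bigcap_(ij in [set ij | ij \in S]) (W ij.1 ij.2 @^-1` `[L, +oo[).
  have mE : measurable E.
    apply: fin_bigcap_measurable => // ij _.
    by rewrite -[X in measurable X]setTI; apply: measurable_funPT.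
  have EW w : E w -> forall i j, L <= W i j w.
    move=> wE i j; wlog ij : i j / (i <= j)%N.
      by move=> H; have [/H//|/ltnW/H] := leqP i j; rewrite Wsym.
    by have := wE (i, j) ij; rewrite /= in_itv /= andbT.
  (* Independence turns [P E] into a finite product of positive Gaussian tails. *)
  have PE : (0 < P E)%E.
    rewrite (Windep (fun=> `[L, +oo[%classic)) => [|k]; last exact: measurable_itv.
    apply: (big_ind (fun x : \bar R => 0 < x)%E) => [|x y|ij _]; first exact: lte01.
      exact: mule_gt0.
    by rewrite -[X in (0 < X)%E]/(distribution P _ _) Wlaw// normal_prob_tail_gt0.
  exists (fine (P E)).
    by rewrite fine_gt0// PE /= -ge0_fin_numE// fin_num_measure.
  move=> n; apply: le_trans (moment_ge Wsym Wmoments n hN L0 mE EW).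
  rewrite mulrC ler_wpM2r ?fine_ge0// exprD.
  have K0' := ltW K0.
  by rewrite -[leLHS]mulr1 ler_pM ?exprn_ge0 ?exprn_ege1// lerXn2r.
have a0 n : 0 < a n.
  (* The rate 1 already bounds [a] below by a positive constant. *)
  have [c c0 ca] := superexp 1 ltr01.
  by apply: lt_le_trans (ca n); rewrite expr1n mulr1.
have ac n : a n.+1 ^+ 2 <= a n * a n.+2 by exact (moment_logconvex Wsym Wmoments (a0 n)).
have Bpsd T x : 0 <= \sum_i \sum_j x i * x j * moments_matrix W T i j.
  have := moment_psd Wsym Wmoments (fun i : 'I_T.+1 => val i) x.
  by under eq_bigr do under eq_bigr do rewrite -moments_matrixE//.
have Bsym T i j : moments_matrix W T i j = moments_matrix W T j i.
  by rewrite !moments_matrixE// addnC.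
have [] := @log_convex_squeeze _ a a0 ac superexp (fun T => \tr (moments_matrix W T))
  (fun T => seqmax (lam T)).
- by move=> T; apply: eq_bigr => l _; rewrite moments_matrixE.
- by move=> T; exact: (seqmax_le_trace (hlam T) (Bpsd T)).
- move=> T; have := sqr_diag_le_seqmax (hlam T) (Bsym T) (Bpsd T) ord_max.
  by rewrite moments_matrixE.
move=> h1 h2; split.
- by under eq_fun do rewrite (sum_eigenvalues (hlam _)).
- by under eq_fun do rewrite moments_matrixE//.
Qed.
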